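(* Let $S=(S,\le)$ be a partially ordered Polish space in which a subset is compact if and only if it is closed and order bounded, let $\mathbb T$ be either $\mathbb R_+$ or $\mathbb Z_+$, and let $(P_t)=(P_t)_{t\in\mathbb T}$ be an increasing transition probability function on $S$. If $(P_t)$ is weakly order mixing, then $(P_t)$ is asymptotically contractive on $\mathcal P(S)$ with respect to the metric $\beta$; that is, $\beta(\phi P_t,\psi P_t)\to0$ as $t\to\infty$ for all $\phi,\psi\in\mathcal P(S)$.
   Context: A partially ordered Polish space is a separable, completely metrizable topological space $S$ with a closed partial order $\le$ (that is, $x_i\le y_i$, $x_i\to x$, $y_i\to y$ imply $x\le y$). A subset is order bounded if it is contained in some order interval $[a,b]=\{x:a\le x\le b\}$ with $a\le b$. $\mathcal B$ is the Borel $\sigma$-algebra, $\mathcal P(S)$ the set of Borel probability measures, $ibS$ the set of bounded Borel measurable increasing functions on $S$, $\phi(h)=\int h\,d\phi$; $\phi\preceq_{\mathrm{sd}}\psi$ means $\phi(h)\le\psi(h)$ for all $h\in ibS$; $\beta(\phi,\psi)=\sup\{|\phi(h)-\psi(h)|:h\in ibS,\ |h|\le1\}$. A stochastic kernel on $S$ is a map $P:S\times\mathcal B\to[0,1]$ with $P(x,\cdot)\in\mathcal P(S)$ and $x\mapsto P(x,B)$ measurable; $(\phi P)(B)=\int P(x,B)\phi(dx)$; it is increasing if $x\le x'$ implies $P(x,\cdot)\preceq_{\mathrm{sd}}P(x',\cdot)$. A transition probability function is a family of stochastic kernels $(P_t)_{t\in\mathbb T}$ with $P_0(x,\cdot)=\delta_x$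 and $P_{s+t}(x,B)=\int P_t(y,B)P_s(x,dy)$; it is increasing if every $P_t$ is. With $(\mathcal F_t)$ the natural filtration, a process $(X_t)_{t\in\mathbb T}$ is $(P_t)$-Markov if $\mathbb P\{X_t\in B\mid\mathcal F_s\}=P_{t-s}(X_s,B)$ for all $s\le t$ in $\mathbb T$, $B\in\mathcal B$. A Markov process with a transition probability function $(R_t)$ is strong Markov if for every $(\mathcal F_t)$-stopping time $\tau$ with $\mathbb P\{\tau<\infty\}=1$, $\mathbb P\{X_{\tau+t}\in B\mid\mathcal F_\tau\}=R_t(X_\tau,B)$ almost surely for all $t$ and $B$. $(P_t)$ is weakly order mixing if there exists an $(S\times S)$-valued strong Markov process $((X_t),(X'_t))$ (strong Markov for its own transition probability function on $S\times S$) on a probability space $(\Omega,\mathcal F,\mathbb P)$ such that (i) $(X_t)$ and $(X'_t)$ are both $(P_t)$-Markov, and (ii) the stopping time $\tau:=\inf\{t\ge0:X_t\le X'_t\}$ is $\mathcal F$-measurable with $\mathbb P_{x,x'}\{\tau<\infty\}=1$ for all $x,x'\in S$, where $\mathbb P_{x,x'}$ is the law conditional on $(X_0,X'_0)=(x,x')$. The two processes need not be independent.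
   Formalization: For T = R_+, the sample paths of (X_t) and (X'_t) are additionally assumed almost surely right-continuous under every P_{x,x'}; without path regularity the claim is false. The laws P_{x,x'} are given as a kernel, with the (strong) Markov properties holding under each. *)

(* Defs.v *)
From HB Require Import structures.
From mathcomp Require Import all_boot all_order all_algebra.
From mathcomp Require Import all_classical all_reals all_analysis.
From mathcomp Require Import measurable_realfun.
Import Order.TTheory GRing.Theory Num.Theory.
Import numFieldNormedType.Exports.

Set Implicit Arguments.
Unset Strict Implicit.
Unset Printing Implicit Defensive.

Local Open Scope classical_set_scope.
Local Open Scope ring_scope.

#[short(type="poTopMeasurableType")]
HB.structure Definition POrderedTopologicalMeasurable
    (d : Order.disp_t) (dm : measure_display) :=
  { T of POrderedTopological d T & Measurable dm T }.

Section PartiallyOrderedPolish.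
Variable R : realType.

Definition separable (S : topologicalType) : Prop :=
  exists2 D : set S, countable D & dense D.

Definition completely_metrizable (S : topologicalType) : Prop :=
  exists dist : S -> S -> R,
    [/\ forall x y, dist x y = 0 <-> x = y,
        forall x y, dist x y = dist y x,
        forall x y z, dist x z <= dist x y + dist y z,
        forall x, nbhs x = filter_from [set e : R | 0 < e]
                             (fun e => [set y | dist x y < e]) &
        forall u : nat -> S,
          (forall e, 0 < e -> exists N : nat, forall m n : nat,
             (N <= m)%N -> (N <= n)%N -> dist (u m) (u n) < e) ->
          exists l : S, u n @[n --> \oo] --> l].

Variables (d : Order.disp_t) (dm : measure_display).
Variable S : poTopMeasurableType d dm.

Definition closed_order : Prop :=
  forall (u v : nat -> S) (x y : S),
    (forall i, (u i <= v i)%O) ->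
    u i @[i --> \oo] --> x -> v i @[i --> \oo] --> y -> (x <= y)%O.

Record po_polish : Prop := {
  po_polish_separable : separable S ;
  po_polish_metrizable : completely_metrizable S ;
  po_polish_closed_order : closed_order ;
  po_polish_borel : (measurable : set (set S)) = <<s (open : set (set S)) >>
}.

Definition order_bounded (A : set S) : Prop :=
  exists a b : S, (a <= b)%O /\ A `<=` [set x | (a <= x <= b)%O].

End PartiallyOrderedPolish.

(* Time is a subset T of R; objects "indexed by T" are total functions on R of
   which only the values at times of T are ever constrained or used. *)
Definition time_set (R : realType) (T : set R) : Prop :=
  T = [set t | 0 <= t] \/ T = range (fun n : nat => n%:R).

Section StochasticOrder.
Context (R : realType) (d : Order.disp_t) (dm : measure_display).
Context (S : poTopMeasurableType d dm).

Definition ibS : set (S -> R) :=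
  [set h : S -> R | [/\ measurable_fun [set: S] h,
               exists M : R, forall x, `|h x| <= M &
               {homo h : x y / (x <= y)%O >-> x <= y}]].

Definition sd_le (phi psi : {measure set S -> \bar R}) : Prop :=
  forall h, ibS h -> \int[phi]_x h x <= \int[psi]_x h x.

(* The supremum is over a nonempty set bounded by 2. *)
Definition beta (phi psi : probability S R) : R :=
  sup [set `|\int[phi]_x h x - \int[psi]_x h x|
      | h in [set h | ibS h /\ forall x, `|h x| <= 1]].

End StochasticOrder.

Section KernelAction.
Context (R : realType) (d1 d2 : measure_display).
Context (E : measurableType d1) (F : measurableType d2).
Variables (phi : probability E R) (P : R.-pker E ~> F).

Definition kact (B : set F) : \bar R := (\int[phi]_x P x B)%E.

Let kact0 : kact set0 = 0%E.
Proof. by rewrite /kact integral0_eq// => x _; rewrite measure0. Qed.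

Let kact_ge0 B : (0 <= kact B)%E.
Proof. exact: integral_ge0. Qed.

Let kact_sigma_additive : semi_sigma_additive kact.
Proof.
move=> B mB tB mUB; rewrite /kact.
rewrite [X in _ --> X](_ : _ = (\sum_(0 <= i <oo) \int[phi]_x P x (B i))%E).
  by apply: is_cvg_ereal_nneg_natsum => n _; exact: integral_ge0.
rewrite -integral_nneseries//; last first.
  by move=> n; exact: measurable_kernel.
by apply: eq_integral => x _; rewrite measure_semi_bigcup.
Qed.

HB.instance Definition _ := isMeasure.Build _ _ _ kact
  kact0 kact_ge0 kact_sigma_additive.

Let kact_setT : kact [set: F] = 1%E.
Proof.
rewrite /kact; under eq_integral do rewrite prob_kernel.
rewrite integral_cst//= mul1e.
exact: probability_setT.
Qed.

HB.instance Definition _ := Measure_isProbability.Build _ _ _ kact kact_setT.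

End KernelAction.

Section MarkovProcesses.
Context (R : realType) (T : set R).
Context (dO dE : measure_display).
Context (Omega : measurableType dO) (E : measurableType dE).

Definition transition_function (P : R -> R.-pker E ~> E) : Prop :=
  (forall x B, measurable B -> P 0 x B = \d_x B) /\
  (forall s t, T s -> T t -> forall x B, measurable B ->
     P (s + t) x B = (\int[P s x]_y P t y B)%E).

(* Y = Q{A | G} almost surely, for G a sub-sigma-algebra. *)
Definition cond_prob (Q : {measure set Omega -> \bar R}) (G : set (set Omega))
    (A : set Omega) (Y : Omega -> \bar R) : Prop :=
  measurable A /\
  exists Y' : Omega -> \bar R,
    [/\ forall B : set (\bar R), measurable B -> G (Y' @^-1` B),
        forall C, G C -> (\int[Q]_(w in C) Y' w)%E = Q (C `&` A) &
        {ae Q, forall w, Y w = Y' w}].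

Definition natural_filtration (X : R -> Omega -> E) (t : R) :
    set (set Omega) :=
  <<s \bigcup_(s in [set s | T s /\ s <= t])
        preimage_set_system [set: Omega] (X s) measurable >>.

Definition markov (Q : {measure set Omega -> \bar R}) (P : R -> R.-pker E ~> E)
    (X : R -> {mfun Omega >-> E}) : Prop :=
  forall s t, T s -> T t -> s <= t -> forall B, measurable B ->
    cond_prob Q (natural_filtration (fun t => X t) s)
      (X t @^-1` B) (fun w => P (t - s) (X s w) B).

Definition stopping_time (X : R -> Omega -> E) (sigma : Omega -> \bar R) :
    Prop :=
  (forall w, sigma w = +oo%E \/ exists2 t, T t & sigma w = t%:E) /\
  (forall t, T t -> natural_filtration X t [set w | (sigma w <= t%:E)%E]).

Definition stopped_sigma_algebra (X : R -> Omega -> E)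
    (sigma : Omega -> \bar R) : set (set Omega) :=
  [set A | measurable A /\ forall t, T t ->
     natural_filtration X t (A `&` [set w | (sigma w <= t%:E)%E])].

(* On the null event sigma = +oo, [fine (sigma w)] is 0; this is harmless since
   [cond_prob] only determines its last argument almost surely. *)
Definition strong_markov (Q : {measure set Omega -> \bar R})
    (P : R -> R.-pker E ~> E) (X : R -> {mfun Omega >-> E}) : Prop :=
  [/\ transition_function P, markov Q P X &
      forall sigma, stopping_time (fun t => X t) sigma ->
        Q [set w | (sigma w < +oo)%E] = 1%E ->
        forall t B, T t -> measurable B ->
          cond_prob Q (stopped_sigma_algebra (fun t => X t) sigma)
            [set w | B (X (fine (sigma w) + t) w)]
            (fun w => P t (X (fine (sigma w)) w) B)].

End MarkovProcesses.

Section OrderMixing.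
Context (R : realType) (T : set R) (d : Order.disp_t) (dm : measure_display).
Context (S : poTopMeasurableType d dm).

Definition increasing_tf (P : R -> R.-pker S ~> S) : Prop :=
  forall t, T t -> forall x y : S, (x <= y)%O -> sd_le (P t x) (P t y).

Definition pair_process (dO : measure_display) (Omega : measurableType dO)
    (X X' : R -> {mfun Omega >-> S}) (t : R) (w : Omega) : S * S :=
  (X t w, X' t w).

Section pair_process_measurable.
Context (dO : measure_display) (Omega : measurableType dO).
Variables (X X' : R -> {mfun Omega >-> S}) (t : R).

Let pair_process_measurable :
  measurable_fun [set: Omega] (pair_process X X' t).
Proof. exact: measurable_fun_pair. Qed.

HB.instance Definition _ := isMeasurableFun.Build _ _ _ _
  (pair_process X X' t) pair_process_measurable.
End pair_process_measurable.

Definition order_time (dO : measure_display) (Omega : measurableType dO)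
    (X X' : R -> Omega -> S) (w : Omega) : \bar R :=
  ereal_inf [set t%:E | t in [set t | T t /\ (X t w <= X' t w)%O]].

Definition right_continuous_path (dO : measure_display)
    (Omega : measurableType dO) (X : R -> Omega -> S) (w : Omega) : Prop :=
  forall t, T t ->
    X s w @[s --> within [set s | T s /\ t <= s] (nbhs t)] --> X t w.

(* A single law on Omega cannot be conditioned on each of the (possibly null)
   events (X_0, X'_0) = z.  As usual for Markov processes, the laws conditional
   on the starting point are therefore given as a kernel z |-> Pr z, with
   (X_0, X'_0) = z under Pr z, and the Markov properties hold under each Pr z;
   the process with initial distribution mu has law \int Pr z mu(dz).
   Right-continuity, the usual standing convention in continuous time, is
   vacuous when T = Z_+; when T = R_+, without it the infimum defining tau need
   not be attained, and X_tau <= X'_tau may fail. *)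
Definition weakly_order_mixing (P : R -> R.-pker S ~> S) : Prop :=
  exists (dO : measure_display) (Omega : measurableType dO)
         (X X' : R -> {mfun Omega >-> S})
         (Pr : R.-pker (S * S) ~> Omega)
         (K : R -> R.-pker (S * S) ~> (S * S)%type),
    let Z : R -> {mfun Omega >-> (S * S)%type} := pair_process X X' in
    let tau := order_time X X' in
    (forall z, [/\ Pr z (Z 0 @^-1` [set z]) = 1%E,
                   {ae Pr z, forall w, right_continuous_path X w /\
                                       right_continuous_path X' w},
                   strong_markov T (Pr z) K Z,
                   markov T (Pr z) P X & markov T (Pr z) P X']) /\
    [/\ stopping_time T (fun t => Z t) tau,
        measurable_fun [set: Omega] tau &
        forall z, Pr z [set w | (tau w < +oo)%E] = 1%E].

Definition asymptotically_contractive (P : R -> R.-pker S ~> S) : Prop :=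
  forall phi psi : probability S R,
    beta (kact phi (P t)) (kact psi (P t))
      @[t --> within T (pinfty_nbhs R)] --> (0 : R).

End OrderMixing.

(* Main.v *)
Require Import Defs.
From HB Require Import structures.
From mathcomp Require Import all_boot all_order all_algebra.
From mathcomp Require Import all_classical all_reals all_analysis.
From mathcomp Require Import measurable_realfun lra.
Import Order.TTheory GRing.Theory Num.Theory.
Import numFieldNormedType.Exports.

Set Implicit Arguments.
Unset Strict Implicit.
Unset Printing Implicit Defensive.

Local Open Scope classical_set_scope.
Local Open Scope ring_scope.

(** The two laws are compared by coupling.  Start the pair process from
    independent positions with laws [phi] and [psi].  Under [Pr z] its
    coordinates at time [t] have laws [P t z.1] and [P t z.2].  On the event
    [tau <= t] the strong Markov property restarts the pair at time [tau] from
    positions [X_tau <= X'_tau] (lemma [order_time_attained]), and the increasing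
    kernel for the remaining time [t - tau] keeps the laws of the two coordinates
    ordered.  Hence, for [h] increasing with values in [0, 1],
    [\int h dP t z.1 <= \int h dP t z.2 + Pr z (tau > t)]
    (lemma [coupling_inequality]).  The error does not depend on [h]; averaging
    over [z], and exchanging the roles of [phi] and [psi], it bounds [beta]
    (lemma [beta_le]), and it vanishes as [t] grows because [tau] is finite
    (lemma [uncoupled_cvg0]).

    The delicate point is the restart.  The strong Markov property describes the
    process at time [tau + u] for a deterministic delay [u], while here the delay
    [t - tau] is random.  Lemma [strong_markov_fixed_time] rounds [tau] down to a
    grid, so that the delay takes countably many values on events of the past of
    [tau], and refines the grid: the times [tau + u] then converge to [t] from
    the right, and right-continuity of the paths gives the identity for
    continuous functions.  The test functions in [beta] are only measurable; the
    identity extends to Borel sets by a Dynkin argument, indicators of closed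
    sets being limits of continuous functions in a metrizable space (lemma
    [conditional_law_borel]). *)

(** * Mixtures of measures *)

Section Mixtures.
Local Open Scope ereal_scope.
Import HBNNSimple.
Context (R : realType) (dE dF : measure_display).
Context (E : measurableType dE) (F : measurableType dF).
Variables (D : set E) (k : E -> {measure set F -> \bar R}).
Hypothesis mD : measurable D.
Hypothesis mk : forall B, measurable B -> measurable_fun D (k ^~ B).

Let nnsfun_integral (mu : {measure set F -> \bar R}) (g : {nnsfun F >-> R}) :
  \int[mu]_y (g y)%:E = \sum_(r \in range g) r%:E * mu (g @^-1` [set r]).
Proof. by rewrite integralT_nnsfun sintegralE. Qed.

Let measurable_nnsfun_integral (g : {nnsfun F >-> R}) :
  measurable_fun D (fun w => \int[k w]_y (g y)%:E).
Proof.
under eq_fun do rewrite nnsfun_integral.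
by apply: emeasurable_fsum => // r; apply: measurable_funeM; exact: mk.
Qed.

Let nnsfun_cvg (f : F -> \bar R) (mf : measurable_fun setT f) :
  (forall y, 0 <= f y) -> forall w,
  \int[k w]_y (nnsfun_approx measurableT mf n y)%:E @[n --> \oo] -->
  \int[k w]_y f y.
Proof.
move=> f0 w; set g := nnsfun_approx measurableT mf.
have fE y : f y = limn (fun n => (g n y)%:E).
  by apply/esym/cvg_lim => //; exact: cvg_nnsfun_approx.
under [X in _ --> X]eq_integral do rewrite fE.
apply: (@cvg_monotone_convergence _ _ _ (k w) setT measurableT
   (fun n y => (g n y)%:E)) => //.
- by move=> n; exact/measurable_EFinP.
- by move=> n y _; rewrite lee_fin.
- by move=> y _ a b ab; rewrite lee_fin; exact/lefP/nd_nnsfun_approx.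
Qed.

Lemma measurable_mixture (f : F -> \bar R) :
  measurable_fun setT f -> (forall y, 0 <= f y) ->
  measurable_fun D (fun w => \int[k w]_y f y).
Proof.
move=> mf f0.
apply: (emeasurable_fun_cvg
  (fun n w => \int[k w]_y (nnsfun_approx measurableT mf n y)%:E)) => //.
by move=> w _; exact: nnsfun_cvg.
Qed.

(** The integral of a mixture of measures only depends on the mixture of the
    masses of each set: this is the monotone limit of the case of simple
    functions, and it is the form in which the law of a random variable or of a
    composed kernel is transferred from sets to functions. *)
Lemma mixture_cvg (Q : {measure set E -> \bar R}) (f : F -> \bar R)
    (mf : measurable_fun setT f) : (forall y, 0 <= f y) ->
  let g := nnsfun_approx measurableT mf in
  \sum_(r \in range (g n)) r%:E * \int[Q]_(w in D) k w (g n @^-1` [set r])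
    @[n --> \oo] --> \int[Q]_(w in D) \int[k w]_y f y.
Proof.
move=> f0 g.
have fE w : \int[k w]_y f y = limn (fun n => \int[k w]_y (g n y)%:E).
  by apply/esym/cvg_lim => //; exact: nnsfun_cvg.
under [X in _ --> X]eq_integral do rewrite fE.
rewrite [X in X @ _](_ : _ = fun n =>
    \int[Q]_(w in D) \int[k w]_y (g n y)%:E); last first.
  apply/funext => n; under [RHS]eq_integral do rewrite nnsfun_integral.
  rewrite ge0_integral_fsum//; last 2 first.
  - by move=> r; apply: measurable_funeM; exact: mk.
  - move=> r w _; have [r0|r0] := leP 0%R r; first by rewrite mule_ge0.
    by rewrite preimage_nnfun0// measure0 mule0.
  apply: eq_fsbigr => r _.
  have [r0|r0] := leP 0%R r.
    by rewrite ge0_integralZl//; exact: mk.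
  by rewrite preimage_nnfun0// !integral0_eq ?mule0// => w _;
    rewrite measure0// mule0.
apply: (@cvg_monotone_convergence _ _ _ Q D mD
   (fun n w => \int[k w]_y (g n y)%:E)) => //.
- by move=> n w _; apply: integral_ge0 => y _; rewrite lee_fin.
- move=> w _ a b ab; apply: ge0_le_integral => //.
  + by move=> y _; rewrite lee_fin.
  + exact/measurable_EFinP.
  + exact/measurable_EFinP.
  + by move=> y _; rewrite lee_fin; exact/lefP/nd_nnsfun_approx.
Qed.

End Mixtures.

Section MixtureLaws.
Local Open Scope ereal_scope.
Import HBNNSimple.
Context (R : realType) (dE dF : measure_display).
Context (E : measurableType dE) (F : measurableType dF).
Variables (D : set E) (k : E -> {measure set F -> \bar R}).
Hypothesis mD : measurable D.
Hypothesis mk : forall B, measurable B -> measurable_fun D (k ^~ B).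

Lemma integral_mixture (Q : {measure set E -> \bar R})
    (nu : {measure set F -> \bar R}) (f : F -> \bar R) :
  (forall B, measurable B -> nu B = \int[Q]_(w in D) k w B) ->
  measurable_fun setT f -> (forall y, 0 <= f y) ->
  \int[nu]_y f y = \int[Q]_(w in D) \int[k w]_y f y.
Proof.
move=> nuE mf f0.
rewrite -(cvg_lim _ (mixture_cvg mD mk (Q := Q) mf f0))//.
have mnu B : measurable B -> measurable_fun [set: unit] (fun=> nu B).
  by move=> _; exact: measurable_cst.
have nu_cvg := @mixture_cvg R _ _ unit F setT (fun=> nu) measurableT mnu
  \d_tt f mf f0.
rewrite integral_dirac// diracT mul1e in nu_cvg.
apply/esym/cvg_lim => //; apply: cvg_trans nu_cvg.
apply: near_eq_cvg; apply: nearW => n; apply: eq_fsbigr => r _.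
by rewrite integral_dirac// diracT mul1e nuE.
Qed.

(** A conditional law given on sets is one on functions: its two sides are the
    mixtures of the point masses at the values of the variable and of the
    conditional law. *)
Lemma integral_conditional_law (Q : {measure set E -> \bar R}) (Y : E -> F)
    (f : F -> \bar R) :
  measurable_fun D Y ->
  (forall B, measurable B -> Q (D `&` Y @^-1` B) = \int[Q]_(w in D) k w B) ->
  measurable_fun setT f -> (forall y, 0 <= f y) ->
  \int[Q]_(w in D) f (Y w) = \int[Q]_(w in D) \int[k w]_y f y.
Proof.
move=> mY YE mf f0.
have mdirac B : measurable B ->
    measurable_fun D (fun w => (\d_(Y w))%R B : \bar R).
  move=> mB; apply/measurable_EFinP.
  by apply: measurableT_comp mY; exact: measurable_indic.
have Y_cvg := @mixture_cvg R _ _ E F D (fun w => (\d_(Y w))%R) mD mdirac Q f mf f0.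
rewrite -(cvg_lim _ (mixture_cvg mD mk (Q := Q) mf f0))//.
transitivity (\int[Q]_(w in D) \int[(\d_(Y w))%R]_y f y).
  by apply: eq_integral => w _; rewrite integral_dirac// diracT mul1e.
apply/esym/cvg_lim => //; apply: cvg_trans Y_cvg.
apply: near_eq_cvg; apply: nearW => n; apply: eq_fsbigr => r _.
congr (_ * _); rewrite -YE//; set B := _ @^-1` [set r].
have mB : measurable (D `&` Y @^-1` B) by apply: mY => //; rewrite /B.
rewrite -[in RHS](setIid D) setIAC -integral_indic//.
apply: eq_integral => w /set_mem Dw; rewrite /= /dirac !indicE.
by congr ((_ : bool)%:R)%:E; apply/idP/idP; rewrite !inE//= => -[].
Qed.

End MixtureLaws.

Section BoundedConvergence.
Local Open Scope ereal_scope.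
Context (R : realType) (dE : measure_display) (E : measurableType dE).

Lemma bounded_convergence (mu : {measure set E -> \bar R}) (D : set E)
    (f_ : (E -> \bar R)^nat) (f : E -> \bar R) :
  measurable D -> mu D < +oo ->
  (forall n, measurable_fun D (f_ n)) -> measurable_fun D f ->
  {ae mu, forall x, D x -> f_ ^~ x @ \oo --> f x} ->
  (forall n x, D x -> 0 <= f_ n x <= 1) ->
  \int[mu]_(x in D) f_ n x @[n --> \oo] --> \int[mu]_(x in D) f x.
Proof.
move=> mD muD mf_ mf f_f f01.
have int1 : mu.-integrable D (cst 1).
  apply/integrableP; split; first exact: measurable_cst.
  under eq_integral do rewrite /cst/= normr1.
  by rewrite integral_cst// mul1e.
have f_1 : {ae mu, forall x n, D x -> `|f_ n x| <= cst 1 x}.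
  by apply: aeW => x n Dx; have /andP[f0 f1] := f01 n x Dx; rewrite gee0_abs.
by have [] := dominated_convergence mD mf_ mf f_f int1 f_1.
Qed.

Lemma integral_bounded01 (mu : {measure set E -> \bar R}) (f : E -> \bar R) :
  mu setT = 1 -> measurable_fun setT f -> (forall x, 0 <= f x <= 1) ->
  0 <= \int[mu]_x f x <= 1.
Proof.
move=> mu1 mf f01; rewrite integral_ge0/=; last by move=> x _; case/andP: (f01 x).
have -> : 1 = \int[mu]_x (cst 1) x by rewrite integral_cst// mul1e.
apply: ge0_le_integral => //.
- by move=> x _; case/andP: (f01 x).
- by move=> x _; case/andP: (f01 x).
Qed.

End BoundedConvergence.

(** * Conditional laws on a metrizable space *)

Section MetrizableApproximation.
Context (R : realType) (S : topologicalType).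
Hypothesis S_metrizable : completely_metrizable R S.

(** The functions are [max 0 (1 - n * rho)], where [rho] is the distance to the
    closed set; they are Lipschitz, and equal to 0 at a point off the closed set
    as soon as [n] is large. *)
Lemma closed_indicator_approx (C : set S) : closed C ->
  exists f : nat -> S -> R,
    [/\ forall n, continuous (f n), forall n x, 0 <= f n x <= 1 &
        forall x, \forall n \near \oo, f n x = \1_C x].
Proof.
move=> cC; have [C0|/set0P[c0 Cc0]] := eqVneq C set0.
  exists (fun _ _ => 0); split => [n x|n x|x]; first exact: cvg_cst.
    by rewrite lexx ler01.
  by apply: nearW => n; rewrite C0 indic0.
have [dist [dist0 distC dist_tri nbhs_dist _]] := S_metrizable.
have dist_ge0 x y : 0 <= dist x y.
  by have := dist_tri x y x; rewrite (distC y x) (dist0 x x).2//; lra.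
pose A x := [set dist x c | c in C].
pose rho x := inf (A x).
have A_inf x : has_inf (A x).
  by split; [exists (dist x c0), c0|exists 0 => _ [c _ <-]].
have rho_ge0 x : 0 <= rho x.
  by apply: lb_le_inf; [exact: (A_inf x).1|move=> _ [c _ <-]].
have rho_lip x y : rho x <= rho y + dist x y.
  rewrite -lerBlDr; apply: lb_le_inf; first exact: (A_inf y).1.
  move=> _ [c Cc <-]; rewrite lerBlDr.
  apply: (@le_trans _ _ (dist x c)).
    by apply: ge_inf; [exact: (A_inf x).2|exists c].
  by rewrite addrC; exact: dist_tri.
have rho_in x : C x -> rho x = 0.
  move=> Cx; apply/eqP; rewrite eq_le rho_ge0 andbT.
  by apply: ge_inf; [exact: (A_inf x).2|exists x => //; exact/dist0].
have rho_out x : ~ C x -> 0 < rho x.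
  move=> nCx; have : nbhs x (~` C) by apply: open_nbhs_nbhs; split => //;
    exact: closed_openC.
  rewrite nbhs_dist => -[e /= e0 eC]; apply: (lt_le_trans e0).
  apply: lb_le_inf; first exact: (A_inf x).1.
  by move=> _ [c Cc <-]; rewrite leNgt; apply/negP => /eC.
exists (fun n x => Num.max 0 (1 - n%:R * rho x)); split.
- move=> n x; apply/cvgrPdist_lt => /= e e0.
  suff : nbhs x [set y | `|Num.max 0 (1 - n%:R * rho x)
    - Num.max 0 (1 - n%:R * rho y)| < e] by [].
  rewrite nbhs_dist.
  exists (e / n.+1%:R) => /=; first by rewrite divr_gt0.
  move=> y /=; rewrite ltr_pdivlMr// => xy.
  have n0 : 0 <= n%:R :> R by [].
  have n1 : n.+1%:R = n%:R + 1 :> R by rewrite -natr1.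
  have lip1 : n%:R * rho x <= n%:R * rho y + n%:R * dist x y.
    by rewrite -mulrDr ler_wpM2l.
  have lip2 : n%:R * rho y <= n%:R * rho x + n%:R * dist x y.
    by rewrite -mulrDr ler_wpM2l// distC.
  have := dist_ge0 x y; rewrite n1 in xy.
  rewrite ltr_norml /Num.max; case: ifPn; case: ifPn; rewrite -?leNgt => *; lra.
- move=> n x; rewrite le_max lexx/= ge_max ler01/= gerBl.
  by rewrite mulr_ge0.
- move=> x; rewrite indicE; have [Cx|nCx] := pselect (C x).
    by apply: nearW => n; rewrite mem_set// rho_in// mulr0 subr0 max_r.
  have r0 := rho_out _ nCx; rewrite memNset//.
  near=> n; apply/max_idPl; rewrite subr_le0 -ler_pdivrMr// div1r.
  near: n; exact: nbhs_infty_ger.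
Unshelve. all: by end_near. Qed.

End MetrizableApproximation.

Section BorelLaws.
Local Open Scope ereal_scope.
Context (R : realType) (d : Order.disp_t) (dm : measure_display).
Context (S : poTopMeasurableType d dm).
Hypothesis S_polish : po_polish R S.

Lemma continuous_borel (f : S -> R) : continuous f -> measurable_fun setT f.
Proof.
move=> cf; apply: (measurability _ (RGenOpens.measurableE R)).
move=> _ [_ [a [b ->] <-]]; rewrite setTI.
rewrite (po_polish_borel S_polish); apply: sub_sigma_algebra.
by apply: open_comp => //; exact: interval_open.
Qed.

(** The sets on which a conditional law is correct form a Dynkin class, which
    contains the closed sets since their indicators are limits of continuous
    functions. *)
Lemma conditional_law_borel (dE : measure_display) (E : measurableType dE)
    (Q : {measure set E -> \bar R}) (D : set E) (Y : E -> S)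
    (k : E -> {measure set S -> \bar R}) :
  measurable D -> Q D < +oo -> measurable_fun D Y ->
  (forall w, k w setT = 1) ->
  (forall f : S -> R, continuous f -> (forall y, (0 <= f y <= 1)%R) ->
     measurable_fun D (fun w => \int[k w]_y (f y)%:E) /\
     \int[Q]_(w in D) (f (Y w))%:E = \int[Q]_(w in D) \int[k w]_y (f y)%:E) ->
  forall B, measurable B -> measurable_fun D (k ^~ B) /\
    Q (D `&` Y @^-1` B) = \int[Q]_(w in D) k w B.
Proof.
move=> mD QD mY k1 kf B.
have mYB A : measurable A -> measurable (D `&` Y @^-1` A) by exact: mY.
have mopen (A : set S) : open A -> measurable A.
  by move=> oA; rewrite (po_polish_borel S_polish); exact: sub_sigma_algebra.
have k_le1 w A : measurable A -> k w A <= 1.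
  by move=> mA; rewrite -(k1 w); apply: le_measure; rewrite ?inE.
pose good A := measurable_fun D (k ^~ A) /\
  Q (D `&` Y @^-1` A) = \int[Q]_(w in D) k w A.
have goodC A : measurable A -> good A -> good (~` A).
  move=> mA [mkA QA].
  have kC w : k w (~` A) = 1 - k w A.
    rewrite -setTD measureD//; first by rewrite setTI [X in X - _]k1.
    by rewrite [X in X < _]k1 ltry.
  have mkC : measurable_fun D (k ^~ (~` A)).
    under eq_fun do rewrite kC.
    by apply: emeasurable_funB => //; exact: measurable_cst.
  split => //.
  have QAoo : Q (D `&` Y @^-1` A) < +oo.
    by apply: le_lt_trans QD; rewrite le_measure ?inE//; exact: mYB.
  have QE : Q D = Q (D `&` Y @^-1` A) + Q (D `&` Y @^-1` (~` A)).
    rewrite -measureU//; [|exact: mYB|exact/mYB/measurableC|].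
      by rewrite -setIUr preimage_setC setUv setIT.
    by rewrite setIACA preimage_setC setICr setI0.
  have kE : Q D = \int[Q]_(w in D) k w A + \int[Q]_(w in D) k w (~` A).
    rewrite -ge0_integralD//.
    under eq_integral => w _.
      rewrite kC addeC subeK; last first.
        by rewrite ge0_fin_numE// (le_lt_trans (k_le1 w _ mA))// ltry.
      over.
    by rewrite integral_cst// mul1e.
  have QAfin : Q (D `&` Y @^-1` A) \is a fin_num by rewrite ge0_fin_numE.
  by rewrite -(addeK (Q _) QAfin) [_ + Q (_ `&` Y @^-1` A)]addeC -QE kE -QA
    [X in X - _]addeC addeK.
have good_closed C : closed C -> good C.
  move=> cC; have mC : measurable C.
    by rewrite -(setCK C); apply/measurableC/mopen; exact: closed_openC.
  have [f [cf f01 f_cvg]] := closed_indicator_approx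
    (po_polish_metrizable S_polish) cC.
  have mf n : measurable_fun setT (EFin \o f n).
    by apply/measurable_EFinP; exact: continuous_borel.
  have f_cvgE y : (f n y)%:E @[n --> \oo] --> ((\1_C y : R))%:E.
    by apply: cvg_near_cst; apply: filterS (f_cvg y) => n ->.
  have k_cvg w : \int[k w]_y (f n y)%:E @[n --> \oo] --> k w C.
    rewrite -(setIT C) -integral_indic//.
    apply: bounded_convergence => //.
    - by rewrite k1 ltry.
    - exact/measurable_EFinP.
    - by apply: aeW => y _.
    - by move=> n y _; rewrite !lee_fin; exact: f01.
  have mkC : measurable_fun D (k ^~ C).
    apply: (emeasurable_fun_cvg (fun n w => \int[k w]_y (f n y)%:E)) => //.
    by move=> n; exact: (kf _ (cf n) (f01 n)).1.
  split; first exact: mkC.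
  have Q_cvg : \int[Q]_(w in D) (f n (Y w))%:E @[n --> \oo] -->
      \int[Q]_(w in D) k w C.
    under eq_fun do rewrite (kf _ (cf _) (f01 _)).2.
    apply: bounded_convergence => //.
    - by move=> n; exact: (kf _ (cf n) (f01 n)).1.
    - by apply: aeW => w _; exact: k_cvg.
    - move=> n w _; apply: integral_bounded01 (k1 w) (mf n) _ => y.
      by rewrite !lee_fin; exact: f01.
  have Q_cvg' : \int[Q]_(w in D) (f n (Y w))%:E @[n --> \oo] -->
      \int[Q]_(w in D) (\1_C (Y w) : R)%:E.
    apply: bounded_convergence => //.
    - by move=> n; exact: measurableT_comp (mf n) mY.
    - apply: (measurableT_comp (f := fun y => (\1_C y : R)%:E)) mY.
      exact/measurable_EFinP.
    - by apply: aeW => w _; exact: f_cvgE.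
    - by move=> n w _; rewrite !lee_fin; exact: f01.
  rewrite (cvg_unique _ Q_cvg Q_cvg')//.
  rewrite -[in LHS](setIid D) setIAC -integral_indic//; last exact: mYB.
  apply: eq_integral => w /set_mem Dw; rewrite !indicE.
  by congr ((_ : bool)%:R)%:E; apply/idP/idP; rewrite !inE//= => -[].
move=> mB; rewrite -/(good B).
apply: (dynkin_induction (po_polish_borel S_polish) _ _ _ goodC).
- by move=> A A' oA oA'; exact: openI.
- by apply: good_closed; exact: closedT.
- move=> A oA; rewrite -(setCK A); apply: goodC; first exact/measurableC/mopen.
  by apply: good_closed; exact: open_closedC.
- move=> F mF tF gF.
  have kE w : k w (\bigcup_n F n) = \sum_(n <oo) k w (F n).
    by apply: measure_semi_bigcup => //; exact: bigcup_measurable.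
  split.
    under eq_fun do rewrite kE.
    by apply: ge0_emeasurable_sum => // n _; exact: (gF n).1.
  under eq_integral do rewrite kE.
  rewrite integral_nneseries//; last by move=> n; exact: (gF n).1.
  rewrite preimage_bigcup setI_bigcupr measure_semi_bigcup//.
  + by apply: eq_eseriesr => n _; exact: (gF n).2.
  + by move=> n; exact: mYB.
  + by move=> i j _ _ [w [[_ Fi] [_ Fj]]]; apply: (tF i j) => //; exists (Y w).
  + by apply: bigcup_measurable => n _; exact: mYB.
- by rewrite -(po_polish_borel S_polish).
Qed.

End BorelLaws.

(** * Times and rounded delays *)

Section Time.
Context (R : realType) (T : set R).
Hypothesis T_time : time_set T.

Lemma time_ge0 t : T t -> 0 <= t.
Proof. by case: T_time => -> //= -[n _ <-]. Qed.

Lemma time0 : T 0.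
Proof. by case: T_time => ->; [exact: lexx|exists 0%N]. Qed.

Lemma timeD s t : T s -> T t -> T (s + t).
Proof.
case: T_time => -> /=; first exact: addr_ge0.
by move=> [m _ <-] [n _ <-]; exists (m + n)%N => //; rewrite natrD.
Qed.

Lemma timeB s t : T s -> T t -> s <= t -> T (t - s).
Proof.
case: T_time => -> /=; first by rewrite subr_ge0.
move=> [m _ <-] [n _ <-]; rewrite ler_nat => mn.
by exists (n - m)%N => //; rewrite natrB.
Qed.

(** Remaining time from [s] to [t], with [s] rounded down to a multiple of
    [1 / n.+1]. At integer times the rounding is exact, so that these values
    are times whichever set of times is considered. *)
Definition grid_delay (n : nat) (t s : R) : R :=
  t - (Num.truncn (n.+1%:R * s))%:R / n.+1%:R.

Lemma grid_delay_time n s t : T s -> T t -> s <= t -> T (grid_delay n t s).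
Proof.
move=> Ts Tt st; have s0 := time_ge0 Ts; rewrite /grid_delay.
have n0 : (0 : R) < n.+1%:R by [].
have := truncn_itv (mulr_ge0 (ltW n0) s0) => /andP[trunc_le _].
case: T_time Ts Tt => -> /=.
- by move=> _ _; rewrite subr_ge0 ler_pdivrMr// (le_trans trunc_le)// mulrC
    ler_wpM2r// ltW.
- move=> [m _ ms] [k _ kt]; rewrite -ms -kt -natrM natrK natrM mulrAC divff//.
  rewrite mul1r; exists (k - m)%N => //; rewrite natrB//.
  by rewrite -(ler_nat R) ms kt.
Qed.

Lemma grid_delay_ge n s t : 0 <= s -> t - s <= grid_delay n t s.
Proof.
move=> s0; have n0 : (0 : R) < n.+1%:R by [].
have := truncn_itv (mulr_ge0 (ltW n0) s0) => /andP[trunc_le _].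
by rewrite lerB// ler_pdivrMr// [s * _]mulrC.
Qed.

Lemma grid_delay_cvg s t : 0 <= s -> grid_delay n t s @[n --> \oo] --> t - s.
Proof.
move=> s0.
apply: (@squeeze_cvgr _ _ _ _ (cst (t - s)) (fun n => t - s + n.+1%:R^-1)).
- apply: nearW => n; rewrite grid_delay_ge//=.
  have n0 : (0 : R) < n.+1%:R by [].
  have := truncn_itv (mulr_ge0 (ltW n0) s0) => /andP[_ lt_trunc].
  have s_le : s <= (Num.truncn (n.+1%:R * s))%:R / n.+1%:R + n.+1%:R^-1.
    by rewrite -[X in _ + X]div1r -mulrDl natr1 ler_pdivlMr// [s * _]mulrC ltW.
  by rewrite /grid_delay -addrA lerD2l lerNl opprD opprK lerBlDr.
- exact: cvg_cst.
- rewrite -[X in _ --> X]addr0; apply: cvgD; first exact: cvg_cst.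
  exact: cvg_harmonic.
Qed.

Lemma cvg_time_within (v : nat -> R) t :
  (forall n, T (v n)) -> (forall n, t <= v n) -> v n @[n --> \oo] --> t ->
  v n @[n --> \oo] --> within [set s | T s /\ t <= s] (nbhs t).
Proof.
move=> Tv tv v_cvg A tA; have := v_cvg _ tA.
rewrite /nbhs/=; apply: (@filterS _ \oo) => n /=; apply.
by split; [exact: Tv|exact: tv].
Qed.

End Time.

(** * The past of a stopping time *)

Lemma sigma_algebra_setI (U : Type) (F : set (set U)) :
  sigma_algebra setT F -> setI_closed F.
Proof. by move/sigma_algebraP => -[]. Qed.

Section Filtration.
Context (R : realType) (T : set R) (dO dE : measure_display).
Context (Omega : measurableType dO) (E : measurableType dE).
Hypothesis T_time : time_set T.

(** The integrand need not be measurable with respect to the conditioning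
    sigma-algebra: it only equals a version of the conditional probability
    almost surely. *)
Lemma cond_prob_integral (Q : {measure set Omega -> \bar R})
    (G : set (set Omega)) (A : set Omega) (Y : Omega -> \bar R) :
  G `<=` measurable -> measurable_fun setT Y -> cond_prob Q G A Y ->
  forall C, G C -> Q (C `&` A) = (\int[Q]_(w in C) Y w)%E.
Proof.
move=> GM mY [mA [Y' [mY' Y'E YY']]] C GC; rewrite -Y'E//.
apply: ae_eq_integral.
- exact: GM.
- by move=> mC B mB; apply: measurableI => //; exact/GM/mY'.
- exact: measurable_funTS.
- by apply: filterS YY' => w -> _.
Qed.

Variable X : R -> {mfun Omega >-> E}.

Let F := natural_filtration T (fun t => X t).

Lemma natural_filtration_measurable t : F t `<=` measurable.
Proof.
apply: smallest_sub; first exact: sigma_algebra_measurable.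
by move=> _ [s _ [B mB <-]]; exact: (measurable_funP (X s)).
Qed.

Lemma natural_filtration_sigma_algebra t : sigma_algebra setT (F t).
Proof. exact: smallest_sigma_algebra. Qed.

Lemma natural_filtration_le s t : s <= t -> F s `<=` F t.
Proof.
move=> st; apply: sub_sigma_algebra2; apply: bigcup_subset => r /= [Tr rs].
by split => //; exact: le_trans st.
Qed.

Variable tau : Omega -> \bar R.
Hypothesis mtau : measurable_fun setT tau.
Hypothesis tau_stop : stopping_time T (fun t => X t) tau.

Let G := stopped_sigma_algebra T (fun t => X t) tau.

Lemma stopped_measurable : G `<=` measurable.
Proof. by move=> A []. Qed.

Lemma stopped_sigma_algebraP : sigma_algebra setT G.
Proof.
have tau_le t : T t -> F t [set w | (tau w <= t%:E)%E] by exact: tau_stop.2.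
split.
- split => // t _; rewrite set0I.
  by have [] := natural_filtration_sigma_algebra t.
- move=> A [mA GA]; split; first exact: measurableD.
  move=> t Tt; have [_ FD _] := natural_filtration_sigma_algebra t.
  have FI := sigma_algebra_setI (natural_filtration_sigma_algebra t).
  rewrite (_ : _ `&` _ = (setT `\` (A `&` [set w | (tau w <= t%:E)%E]))
     `&` [set w | (tau w <= t%:E)%E]); last first.
    apply/seteqP; split => w /= [[_ nA] tw]; split => //; split => //.
      by case.
    by move=> Aw; apply: nA.
  by apply: FI; [apply: FD; exact: GA|exact: tau_le].
- move=> A GA; split; first by apply: bigcupT_measurable => n; exact: (GA n).1.
  move=> t Tt; have [_ _ FU] := natural_filtration_sigma_algebra t.
  by rewrite setI_bigcupl; apply: FU => n; apply: (GA n).2.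
Qed.

(** For [c] in between two integer times, [tau <= c] is [tau <= floor c]. *)
Lemma stopped_le (c : R) : G [set w | (tau w <= c%:E)%E].
Proof.
split; first by rewrite -[X in measurable X]setTI; exact: emeasurable_fun_infty_c.
move=> t Tt.
have [c0|c0] := ltP c 0.
  rewrite (_ : _ `&` _ = set0).
    by have [] := natural_filtration_sigma_algebra t.
  apply/seteqP; split => // w /= [tc _].
  have [tw|[s Ts sw]] := tau_stop.1 w; first by rewrite tw leye_eq in tc.
  rewrite sw lee_fin in tc.
  by have := time_ge0 T_time Ts; rewrite leNgt (le_lt_trans tc).
have [r [Tr rc rmax]] : exists r, [/\ T r, r <= c &
    forall s, T s -> s <= c -> s <= r].
  case: T_time => ->; first by exists c; split.
  exists (Num.truncn c)%:R; split; first by exists (Num.truncn c).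
    by have /andP[] := truncn_itv c0.
  by move=> _ [m _ <-]; rewrite ler_nat -truncn_ge_nat.
have Tm : T (Num.min r t) by rewrite /Num.min; case: ifP.
rewrite (_ : _ `&` _ = [set w | (tau w <= (Num.min r t)%:E)%E]).
  apply: (natural_filtration_le (s := Num.min r t)); last exact: tau_stop.2.
  by rewrite ge_min lexx orbT.
apply/seteqP; split => w /=.
- move=> []; have [->|[s Ts ->]] := tau_stop.1 w; first by rewrite leye_eq.
  by rewrite !lee_fin le_min => sc ->; rewrite rmax.
- have [->|[s Ts ->]] := tau_stop.1 w; first by rewrite leye_eq.
  rewrite !lee_fin le_min => /andP[sr ->]; split => //.
  exact: le_trans rc.
Qed.

Lemma stopped_lt (c : R) : G [set w | (tau w < c%:E)%E].
Proof.
have [_ _ GU] := stopped_sigma_algebraP.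
rewrite (_ : mkset _ = \bigcup_n [set w | (tau w <= (c - n.+1%:R^-1)%:E)%E]).
  by apply: GU => n; exact: stopped_le.
apply/seteqP; split => w /=.
- have [->|[s Ts sw]] := tau_stop.1 w; first by rewrite ltNge leey.
  rewrite sw lte_fin -subr_gt0 => cs.
  have [n _ /(_ n (leqnn n)) ns] := near_infty_natSinv_lt (PosNum cs).
  by exists n => //=; rewrite sw lee_fin lerBrDr -lerBrDl ltW.
- move=> [n _ /=]; move/le_lt_trans; apply; rewrite lte_fin.
  by rewrite ltrBlDr ltrDl invr_gt0.
Qed.

Lemma stopped_grid (n k : nat) (t : R) :
  G [set w | (tau w <= t%:E)%E /\ Num.truncn (n.+1%:R * fine (tau w)) = k].
Proof.
have GI := sigma_algebra_setI stopped_sigma_algebraP.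
have [_ GD _] := stopped_sigma_algebraP.
rewrite (_ : mkset _ = [set w | (tau w <= t%:E)%E] `&`
    ((setT `\` [set w | (tau w < (k%:R / n.+1%:R)%:E)%E]) `&`
     [set w | (tau w < (k.+1%:R / n.+1%:R)%:E)%E])).
  apply: (GI); first exact: stopped_le.
  by apply: (GI); [apply: GD|]; exact: stopped_lt.
have n0 : (0 : R) < n.+1%:R by [].
apply/seteqP; split => w /=.
- have [->|[s Ts ->]] := tau_stop.1 w; first by rewrite leye_eq => -[].
  have s0 : 0 <= n.+1%:R * s by rewrite mulr_ge0// (time_ge0 T_time).
  move=> /= [-> <-]; rewrite !lte_fin !ltr_pdivlMr// ![s * _]mulrC.
  have /andP[le_s lt_s] := truncn_itv s0.
  by split => //; split => //; split => //; apply/negP; rewrite -leNgt.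
- have [->|[s Ts ->]] := tau_stop.1 w; first by rewrite leye_eq => -[].
  move=> /= [-> [[_ /negP]]]; rewrite !lte_fin -leNgt ler_pdivrMr ?ltr_pdivlMr//.
  rewrite ![s * _]mulrC => le_s lt_s; split => //.
  by apply: truncn_def; rewrite le_s.
Qed.

End Filtration.

(** * Strong Markov property at a fixed time *)

Section RandomDelay.
Local Open Scope ereal_scope.
Context (R : realType) (T : set R) (d : Order.disp_t) (dm : measure_display).
Context (S : poTopMeasurableType d dm) (P : R -> R.-pker S ~> S).
Hypothesis S_polish : po_polish R S.
Hypothesis T_time : time_set T.
Hypothesis P_right : forall (f : S -> R) (x : S) (v : nat -> R) (u : R),
  continuous f -> (forall y, (0 <= f y <= 1)%R) -> T u ->
  (forall n, T (v n)) -> (forall n, (u <= v n)%R) -> v n @[n --> \oo] --> u ->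
  \int[P (v n) x]_y (f y)%:E @[n --> \oo] --> \int[P u x]_y (f y)%:E.

Context (dO : measure_display) (Omega : measurableType dO).
Variables (Q : {measure set Omega -> \bar R}) (tau : Omega -> \bar R).
Variables (G : set (set Omega)) (Y : R -> {mfun Omega >-> S}).
Hypothesis Q1 : Q setT = 1.
Hypothesis Y_right : {ae Q, forall w, right_continuous_path T Y w}.
Hypothesis tau_time : forall w, tau w = +oo \/ exists2 t, T t & tau w = t%:E.
Hypothesis GM : G `<=` measurable.
Hypothesis G_le : forall c : R, G [set w | tau w <= c%:E].
Hypothesis G_grid : forall (n k : nat) (t : R),
  G [set w | tau w <= t%:E /\ Num.truncn (n.+1%:R * fine (tau w)) = k].
Hypothesis mY_delay : forall u, T u ->
  measurable_fun setT (fun w => Y (fine (tau w) + u) w).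
Hypothesis Y_delay : forall u, T u -> forall C B, G C -> measurable B ->
  Q (C `&` [set w | B (Y (fine (tau w) + u) w)]) =
  \int[Q]_(w in C) P u (Y (fine (tau w)) w) B.

Variable t : R.
Hypothesis Tt : T t.

Let D := [set w | tau w <= t%:E].
Let V w := Y (fine (tau w)) w.

Let D_time w : D w -> T (fine (tau w)) /\ (fine (tau w) <= t)%R.
Proof.
rewrite /D/=; have [->|[s Ts ->]] := tau_time w; first by rewrite leye_eq.
by rewrite lee_fin.
Qed.

Let mD : measurable D. Proof. exact/GM/G_le. Qed.

Let mV : measurable_fun setT V.
Proof. by have := mY_delay (time0 T_time); under eq_fun do rewrite addr0. Qed.

Let QD : Q D < +oo.
Proof. by rewrite (@le_lt_trans _ _ 1) ?ltry// -Q1 le_measure ?inE. Qed.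

Section grid.
Variables (n : nat) (f : S -> R).
Hypothesis mf : measurable_fun setT f.
Hypothesis f01 : forall y, (0 <= f y <= 1)%R.

Let delay w := grid_delay n t (fine (tau w)).
Let C k := [set w | tau w <= t%:E /\ Num.truncn (n.+1%:R * fine (tau w)) = k].
Let u_ (k : nat) : R := (t - k%:R / n.+1%:R)%R.

Let D_bigcup : D = \bigcup_k C k.
Proof.
apply/seteqP; split => w /=; last by move=> [k _ []].
by move=> Dw; exists (Num.truncn (n.+1%:R * fine (tau w))).
Qed.

Let mC k : measurable (C k). Proof. exact/GM/G_grid. Qed.

Let trivC : trivIset setT C.
Proof. by move=> i j _ _ [w [[_ <-] [_ <-]]]. Qed.

Let delayE k w : C k w -> delay w = u_ k.
Proof. by move=> [_ <-]. Qed.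

Let u_time k w : C k w -> T (u_ k).
Proof.
move=> Cw; rewrite -(delayE Cw); have [Ts st] := D_time Cw.1.
exact: grid_delay_time.
Qed.

Let f0 y : 0 <= (f y)%:E. Proof. by rewrite lee_fin; case/andP: (f01 y). Qed.

Let mfE : measurable_fun setT (EFin \o f). Proof. exact/measurable_EFinP. Qed.

Lemma measurable_grid_process :
  measurable_fun D (fun w => (f (Y (fine (tau w) + delay w) w))%:E).
Proof.
rewrite D_bigcup; apply/measurable_fun_bigcup => // k.
have [->|/set0P[w0 Cw0]] := eqVneq (C k) set0; first exact: measurable_fun_set0.
apply: (eq_measurable_fun (fun w => (f (Y (fine (tau w) + u_ k) w))%:E)).
  by move=> w /set_mem Cw; rewrite (delayE Cw).
apply: (measurableT_comp (f := EFin \o f)) => //.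
exact: measurable_funTS (mY_delay (u_time Cw0)).
Qed.

Lemma measurable_grid_kernel :
  measurable_fun D (fun w => \int[P (delay w) (V w)]_y (f y)%:E).
Proof.
rewrite D_bigcup; apply/measurable_fun_bigcup => // k.
apply: (eq_measurable_fun (fun w => \int[P (u_ k) (V w)]_y (f y)%:E)).
  by move=> w /set_mem Cw; rewrite (delayE Cw).
apply: measurable_mixture => // B mB.
exact: measurable_funTS (measurableT_comp (measurable_kernel (P (u_ k)) _ mB) mV).
Qed.

(** The rounded delay takes countably many values, each on an event of the past
    of [tau], and the strong Markov property applies on each of them. *)
Lemma integral_grid :
  \int[Q]_(w in D) (f (Y (fine (tau w) + delay w) w))%:E =
  \int[Q]_(w in D) \int[P (delay w) (V w)]_y (f y)%:E.
Proof.
have mP := measurable_grid_process; have mK := measurable_grid_kernel.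
rewrite D_bigcup in mP mK *.
rewrite ge0_integral_bigcup//.
rewrite ge0_integral_bigcup//; last by move=> w _; exact: integral_ge0.
apply: eq_eseriesr => k _.
have [->|/set0P[w0 Cw0]] := eqVneq (C k) set0; first by rewrite !integral_set0.
have Tu := u_time Cw0.
transitivity (\int[Q]_(w in C k) ((EFin \o f) (Y (fine (tau w) + u_ k) w))).
  by apply: eq_integral => w /set_mem Cw; rewrite (delayE Cw).
rewrite (@integral_conditional_law _ _ _ _ _ _
    (fun w => P (u_ k) (V w)) (mC k))//.
- by apply: eq_integral => w /set_mem Cw; rewrite (delayE Cw).
- move=> B mB.
  exact: measurable_funTS (measurableT_comp (measurable_kernel (P (u_ k)) _ mB) mV).
- exact: measurable_funTS (mY_delay Tu).
- by move=> B mB; rewrite -Y_delay//; exact: G_grid.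
Qed.

End grid.

(** The strong Markov property only gives the law at a fixed delay after [tau].
    At the fixed time [t], the delay [t - tau] is random: it is a limit from the
    right of delays with countably many values, and right-continuity of the
    paths makes both sides of the identity converge for continuous functions. *)
Lemma strong_markov_fixed_time : forall B, measurable B ->
  measurable_fun D (fun w => P (t - fine (tau w)) (V w) B) /\
  Q (D `&` Y t @^-1` B) = \int[Q]_(w in D) P (t - fine (tau w)) (V w) B.
Proof.
apply: (conditional_law_borel S_polish (k := fun w => P (t - fine (tau w)) (V w)))
  => //.
- exact: measurable_funTS.
- by move=> w; exact: prob_kernel.
move=> f cf f01.
have mf := continuous_borel S_polish cf.
have f01E y : 0 <= (f y)%:E <= 1 by rewrite !lee_fin.
have kernel_cvg w : D w ->
    \int[P (grid_delay n t (fine (tau w))) (V w)]_y (f y)%:E @[n --> \oo] -->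
    \int[P (t - fine (tau w)) (V w)]_y (f y)%:E.
  move=> Dw; have [Ts st] := D_time Dw; have s0 := time_ge0 T_time Ts.
  apply: P_right => //.
  - exact: timeB.
  - by move=> n; exact: grid_delay_time.
  - by move=> n; exact: grid_delay_ge.
  - exact: grid_delay_cvg.
have mK : measurable_fun D (fun w => \int[P (t - fine (tau w)) (V w)]_y (f y)%:E).
  apply: (emeasurable_fun_cvg
    (fun n w => \int[P (grid_delay n t (fine (tau w))) (V w)]_y (f y)%:E)) => //.
  by move=> n; exact: measurable_grid_kernel.
split=> //.
have path_cvg : {ae Q, forall w, D w ->
    (f (Y (fine (tau w) + grid_delay n t (fine (tau w))) w))%:E @[n --> \oo]
    --> (f (Y t w))%:E}.
  apply: filterS Y_right => w Yw Dw; have [Ts st] := D_time Dw.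
  have s0 := time_ge0 T_time Ts.
  have time_cvg : (fine (tau w) + grid_delay n t (fine (tau w)))%R @[n --> \oo] -->
      within [set s | T s /\ (t <= s)%R] (nbhs t).
    apply: cvg_time_within.
    - by move=> n; apply: timeD => //; exact: grid_delay_time.
    - by move=> n; rewrite -lerBlDl grid_delay_ge.
    - rewrite -[X in _ --> X](subrKC (fine (tau w))); apply: cvgD.
        exact: cvg_cst.
      exact: grid_delay_cvg.
  apply: cvg_EFin; first exact: nearW.
  exact: cvg_comp (cvg_comp _ _ time_cvg (Yw t Tt)) (cf (Y t w)).
have Y_cvg : \int[Q]_(w in D)
    (f (Y (fine (tau w) + grid_delay n t (fine (tau w))) w))%:E @[n --> \oo] -->
    \int[Q]_(w in D) (f (Y t w))%:E.
  apply: bounded_convergence => //.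
  - by move=> n; exact: measurable_grid_process.
  - apply/measurable_EFinP; apply: measurableT_comp => //.
    exact: measurable_funTS.
have K_cvg : \int[Q]_(w in D)
    (f (Y (fine (tau w) + grid_delay n t (fine (tau w))) w))%:E @[n --> \oo] -->
    \int[Q]_(w in D) \int[P (t - fine (tau w)) (V w)]_y (f y)%:E.
  under eq_fun do rewrite integral_grid//.
  apply: bounded_convergence => //.
  - by move=> n; exact: measurable_grid_kernel.
  - exact: aeW.
  - move=> n w _; apply: integral_bounded01 => //; first exact: prob_kernel.
    exact/measurable_EFinP.
exact: cvg_unique Y_cvg K_cvg.
Qed.

End RandomDelay.

(** * Bounding the metric by test functions *)

Section BetaMetric.
Context (R : realType) (d : Order.disp_t) (dm : measure_display).
Context (S : poTopMeasurableType d dm).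

Lemma bounded_probability_integrable (mu : probability S R) (f : S -> R)
    (M : R) :
  measurable_fun setT f -> (forall x, `|f x| <= M) ->
  mu.-integrable setT (EFin \o f).
Proof.
move=> mf fM; apply: measurable_bounded_integrable => //.
  by rewrite [X in (X < _)%E]probability_setT ltry.
exists M; split; first exact: num_real.
by move=> N MN x _; exact: le_trans (fM x) (ltW MN).
Qed.

(** The affine map [h |-> (h + 1) / 2] reduces test functions with values in
    [-1, 1] to test functions with values in [0, 1]. *)
Lemma beta_le (mu nu : probability S R) (e : R) :
  (forall g : S -> R, measurable_fun setT g -> (forall y, 0 <= g y <= 1) ->
     {homo g : x y / (x <= y)%O >-> x <= y} ->
     (\int[mu]_y (g y)%:E <= \int[nu]_y (g y)%:E + e%:E)%E /\
     (\int[nu]_y (g y)%:E <= \int[mu]_y (g y)%:E + e%:E)%E) ->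
  0 <= beta mu nu <= 2 * e.
Proof.
move=> mu_nu; rewrite /beta; set A := (X in sup X).
have A_ub : ubound A (2 * e).
  move=> _ [h [[mh _ h_incr] h1] <-].
  pose g x := 2^-1 * (h x + 1).
  have mg : measurable_fun setT g.
    by apply: measurable_funM => //; apply: measurable_funD.
  have g01 y : 0 <= g y <= 1.
    by have := h1 y; rewrite ler_norml /g => /andP[? ?]; apply/andP; split; lra.
  have g_incr : {homo g : x y / (x <= y)%O >-> x <= y}.
    by move=> x y xy; rewrite /g ler_wpM2l// lerD2r h_incr.
  have gE (m : probability S R) :
      \int[m]_x g x = 2^-1 * (\int[m]_x h x + 1).
    have ih := bounded_probability_integrable m mh h1.
    have i1 : m.-integrable setT (EFin \o cst (1 : R)).
      by apply: (@bounded_probability_integrable m _ 1) => // x; rewrite normr1.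
    have i2 : m.-integrable setT (EFin \o (fun x => h x + 1)).
      apply: (@bounded_probability_integrable m _ 2).
        exact: measurable_funD.
      by move=> x; have := h1 x; rewrite !ler_norml => /andP[? ?];
        apply/andP; split; lra.
    rewrite RintegralZl// RintegralD// Rintegral_cst//.
    by rewrite [X in fine X]probability_setT mul1r.
  have gfin (m : probability S R) : (\int[m]_x (g x)%:E)%E = (\int[m]_x g x)%:E.
    rewrite /Rintegral fineK//; apply: integrable_fin_num => //.
    apply: (@bounded_probability_integrable m _ 1) => // x.
    by have /andP[? ?] := g01 x; rewrite ger0_norm.
  have [] := mu_nu g mg g01 g_incr.
  rewrite !gfin -!EFinD !lee_fin !gE ler_norml => ? ?.
  by apply/andP; split; lra.
have A0 : A 0.
  exists (cst 0); last by rewrite !Rintegral_cst// !mul0r subrr normr0.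
  split; last by move=> x; rewrite normr0.
  by split => //; exists 0 => x; rewrite normr0.
apply/andP; split.
  by apply: ub_le_sup => //; exists (2 * e).
by apply: ge_sup => //; exists 0.
Qed.

End BetaMetric.

(** * The coupling *)

Section Coupling.
Local Open Scope ereal_scope.
Context (R : realType) (T : set R) (d : Order.disp_t) (dm : measure_display).
Context (S : poTopMeasurableType d dm).
Hypothesis S_polish : po_polish R S.
Hypothesis T_time : time_set T.

Lemma polish_measurable_set1 (x : S) : measurable [set x].
Proof.
have [dist [dist0 distC dist_tri nbhs_dist _]] :=
  po_polish_metrizable S_polish.
rewrite -(setCK [set x]); apply: measurableC.
rewrite (po_polish_borel S_polish); apply: sub_sigma_algebra.
rewrite /= openE => y /= /eqP yx; rewrite /interior nbhs_dist.
have dist_ge0 a b : (0 <= dist a b)%R.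
  by have := dist_tri a b a; rewrite (distC b a) (dist0 a a).2//; lra.
exists (dist y x) => /=.
  rewrite lt0r dist_ge0 andbT; apply/eqP => /dist0 xy.
  by rewrite xy eqxx in yx.
by move=> z /= yz zx; rewrite zx ltxx in yz.
Qed.

(** The Markov property at time 0, where the process is almost surely at its
    starting point, identifies its one-dimensional laws. *)
Lemma markov_law (dO dE : measure_display) (Omega : measurableType dO)
    (E : measurableType dE) (Q : {measure set Omega -> \bar R})
    (K : R -> R.-pker E ~> E) (X : R -> {mfun Omega >-> E}) (x : E) (t : R) :
  measurable [set x] -> Q setT = 1 -> Q (X 0%R @^-1` [set x]) = 1 ->
  Defs.markov T Q K X -> T t ->
  forall B, measurable B -> Q (X t @^-1` B) = K t x B.
Proof.
move=> mx Q1 Qx XK Tt B mB; have T0 := time0 T_time.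
have XKB := XK 0%R t T0 Tt (time_ge0 T_time Tt) B mB.
rewrite -(setTI (_ @^-1` B)) (cond_prob_integral _ _ XKB); last 3 first.
- exact: natural_filtration_measurable.
- rewrite subr0.
  exact: measurableT_comp (measurable_kernel (K t) _ mB) (measurable_funP (X 0%R)).
- have [F0 FC _] := natural_filtration_sigma_algebra T X 0%R.
  by rewrite -(setD0 setT); exact: FC.
have mXx : measurable (X 0%R @^-1` [set x]) by exact: measurable_funPTI.
have X0 : {ae Q, forall w, X 0%R w = x}.
  exists (~` (X 0%R @^-1` [set x])); split => //; first exact: measurableC.
  rewrite -setTD measureD//; last by rewrite [X in X < _]Q1 ltry.
  by rewrite setTI [X in X - _]Q1 [X in _ - X]Qx subee.
rewrite subr0 (ae_eq_integral (cst (K t x B)))//.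
- by rewrite integral_cst// Q1 mule1.
- exact: measurableT_comp (measurable_kernel (K t) _ mB) (measurable_funP (X 0%R)).
- by apply: filterS X0 => w -> _.
Qed.

Variable P : R -> R.-pker S ~> S.

Section one_start.
Context (dO : measure_display) (Omega : measurableType dO).
Variables (Q : {measure set Omega -> \bar R}) (X : R -> {mfun Omega >-> S}).
Variables (x : S).
Hypothesis Q1 : Q setT = 1.
Hypothesis X_law : forall t, T t ->
  forall B, measurable B -> Q (X t @^-1` B) = P t x B.

Lemma integral_markov_law (f : S -> \bar R) (t : R) :
  measurable_fun setT f -> (forall y, 0 <= f y) -> T t ->
  \int[P t x]_y f y = \int[Q]_w f (X t w).
Proof.
move=> mf f0 Tt.
transitivity (\int[Q]_w cst (\int[P t x]_y f y) w).
  by rewrite integral_cst// [X in _ * X]Q1 mule1.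
apply/esym; apply: (integral_conditional_law (k := fun=> P t x)) => //.
move=> B mB; rewrite setTI X_law//.
rewrite (_ : (fun=> _) = cst (P t x B))//.
by rewrite integral_cst// [X in _ * X]Q1 mule1.
Qed.

Hypothesis X_right : {ae Q, forall w, right_continuous_path T X w}.

(** Right-continuity of the paths makes the semigroup right-continuous in time
    on continuous functions. *)
Lemma kernel_right_cvg (f : S -> R) (v : nat -> R) (u : R) :
  continuous f -> (forall y, (0 <= f y <= 1)%R) -> T u ->
  (forall n, T (v n)) -> (forall n, (u <= v n)%R) -> v n @[n --> \oo] --> u ->
  \int[P (v n) x]_y (f y)%:E @[n --> \oo] --> \int[P u x]_y (f y)%:E.
Proof.
move=> cf f01 Tu Tv uv v_cvg; have mf := continuous_borel S_polish cf.
have mfE : measurable_fun setT (EFin \o f) by exact/measurable_EFinP.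
have f0 y : 0 <= (f y)%:E by rewrite lee_fin; case/andP: (f01 y).
rewrite (integral_markov_law mfE)//.
under eq_fun do rewrite (integral_markov_law mfE)//.
apply: bounded_convergence => //.
- by rewrite Q1 ltry.
- by move=> n; exact: measurableT_comp mfE _.
- exact: measurableT_comp mfE _.
- apply: filterS X_right => w Xw _; have Xu := Xw u Tu.
  apply: cvg_EFin; first exact: nearW.
  exact: cvg_comp (cvg_comp _ _ (cvg_time_within Tv uv v_cvg) Xu) (cf (X u w)).
- by move=> n w _; rewrite !lee_fin.
Qed.

End one_start.

(** The infimum is a limit from the right of times at which the two paths are
    ordered, and the order is closed. *)
Lemma order_time_attained (dO : measure_display) (Omega : measurableType dO)
    (X X' : R -> Omega -> S) (w : Omega) (s : R) :
  T s -> order_time T X X' w = s%:E ->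
  right_continuous_path T X w -> right_continuous_path T X' w ->
  (X s w <= X' s w)%O.
Proof.
move=> Ts tau_s Xw X'w.
have tau_lb r : T r -> (X r w <= X' r w)%O -> (s <= r)%R.
  move=> Tr rX; rewrite -lee_fin -tau_s; apply: ereal_inf_lbound.
  by exists r.
have near_s (n : nat) : exists r, [/\ T r, (X r w <= X' r w)%O &
    (r < s + n.+1%:R^-1)%R].
  have : order_time T X X' w < (s + n.+1%:R^-1)%:E.
    by rewrite tau_s lte_fin ltrDl invr_gt0.
  by move=> /ereal_inf_lt[_ [r [Tr rX] <-]]; rewrite lte_fin => rs; exists r.
have [v vP] := choice near_s.
have Tv n : T (v n) by have [] := vP n.
have v_le n : (X (v n) w <= X' (v n) w)%O by have [] := vP n.
have sv n : (s <= v n)%R by exact: tau_lb.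
have v_cvg : v n @[n --> \oo] --> s.
  apply: (@squeeze_cvgr _ _ _ _ (cst s) (fun n => s + n.+1%:R^-1)%R).
  - by apply: nearW => n; rewrite sv/=; have [_ _ /ltW] := vP n.
  - exact: cvg_cst.
  - rewrite -[X in _ --> X]addr0; apply: cvgD; first exact: cvg_cst.
    exact: cvg_harmonic.
have v_within := cvg_time_within Tv sv v_cvg.
apply: (po_polish_closed_order S_polish v_le).
- exact: cvg_comp v_within (Xw s Ts).
- exact: cvg_comp v_within (X'w s Ts).
Qed.

Context (dO : measure_display) (Omega : measurableType dO).
Variables (X X' : R -> {mfun Omega >-> S}).
Variables (Pr : R.-pker (S * S) ~> Omega).
Variables (K : R -> R.-pker (S * S) ~> (S * S)%type).
Let Z : R -> {mfun Omega >-> (S * S)%type} := pair_process X X'.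
Let tau := order_time T X X'.
Hypothesis P_incr : increasing_tf T P.
Hypothesis Z_start : forall z, Pr z (Z 0%R @^-1` [set z]) = 1.
Hypothesis Z_right : forall z, {ae Pr z, forall w,
  right_continuous_path T X w /\ right_continuous_path T X' w}.
Hypothesis Z_strong : forall z, strong_markov T (Pr z) K Z.
Hypothesis X_markov : forall z, Defs.markov T (Pr z) P X.
Hypothesis X'_markov : forall z, Defs.markov T (Pr z) P X'.
Hypothesis tau_stop : stopping_time T (fun t => Z t) tau.
Hypothesis mtau : measurable_fun setT tau.
Hypothesis tau_fin : forall z, Pr z [set w | tau w < +oo] = 1.

Let Pr1 z : Pr z setT = 1. Proof. exact: prob_kernel. Qed.

Let measurable_pair (z : S * S) : measurable [set z].
Proof.
rewrite (_ : [set z] = [set z.1] `*` [set z.2]).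
  by apply: measurableX; exact: polish_measurable_set1.
by apply/seteqP; split => [_ ->//|[a b] /= [-> ->]]; case: z.
Qed.

Let start_marginal (pi : S * S -> S) (W : R -> {mfun Omega >-> S}) z :
  (forall t w, W t w = pi (Z t w)) -> measurable_fun setT pi ->
  Pr z (W 0%R @^-1` [set pi z]) = 1.
Proof.
move=> WE mpi; apply/eqP; rewrite eq_le; apply/andP; split.
  rewrite -(Pr1 z); apply: le_measure; rewrite ?inE//.
  by apply: measurable_funPTI; exact: polish_measurable_set1.
rewrite -(Z_start z); apply: le_measure; rewrite ?inE.
- by apply: measurable_funPTI; exact: measurable_pair.
- by apply: measurable_funPTI; exact: polish_measurable_set1.
- by move=> w Zw; rewrite /= WE; exact: (congr1 pi Zw).
Qed.

Section coordinate.
Variables (pi : S * S -> S) (W : R -> {mfun Omega >-> S}).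
Hypothesis WE : forall t w, W t w = pi (Z t w).
Hypothesis mpi : measurable_fun setT pi.
Hypothesis pi_diag : forall x, pi (x, x) = x.
Hypothesis W_markov : forall z, Defs.markov T (Pr z) P W.
Hypothesis W_right : forall z, {ae Pr z, forall w, right_continuous_path T W w}.

Lemma coordinate_law z t : T t -> forall B, measurable B ->
  Pr z (W t @^-1` B) = P t (pi z) B.
Proof.
move=> Tt; apply: markov_law => //.
- exact: polish_measurable_set1.
- exact: start_marginal.
Qed.

(** The coordinates are Markov for their own filtrations only, whereas [tau]
    depends on both.  The strong Markov property of the pair is nevertheless
    expressed with [P], because the marginal of [K t z] and [P t (pi z)] are both
    the law of the coordinate at time [t] under [Pr z]. *)
Lemma coordinate_kernel z t B : T t -> measurable B ->
  K t z (pi @^-1` B) = P t (pi z) B.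
Proof.
move=> Tt mB; have [_ Z_markov _] := Z_strong z.
have mpB : measurable (pi @^-1` B) by rewrite -[X in measurable X]setTI; exact: mpi.
rewrite -coordinate_law// -(markov_law _ _ _ Z_markov Tt)//.
by congr (Pr z _); apply/seteqP; split => w /=; rewrite WE.
Qed.

Lemma coordinate_strong_markov z t : T t ->
  let D := [set w | tau w <= t%:E] in
  forall B, measurable B ->
  measurable_fun D (fun w => P (t - fine (tau w)) (W (fine (tau w)) w) B) /\
  Pr z (D `&` W t @^-1` B) =
  \int[Pr z]_(w in D) P (t - fine (tau w)) (W (fine (tau w)) w) B.
Proof.
move=> Tt; have [_ _ /(_ tau tau_stop (tau_fin z)) Z_tau] := Z_strong z.
have GM := @stopped_measurable _ T _ _ _ _ Z tau.
have mW u : T u -> measurable_fun setT (fun w => W (fine (tau w) + u) w).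
  move=> Tu _ B mB; rewrite setTI.
  have mpB : measurable (pi @^-1` B).
    by rewrite -[X in measurable X]setTI; exact: mpi.
  have [mA _] := Z_tau u _ Tu mpB.
  rewrite (_ : _ @^-1` B = [set w | (pi @^-1` B) (Z (fine (tau w) + u) w)])//.
  by apply/seteqP; split => w /=; rewrite WE.
have mZ0 : measurable_fun setT (fun w => Z (fine (tau w)) w).
  move=> _ B mB; rewrite setTI; have [mA _] := Z_tau 0%R _ (time0 T_time) mB.
  by under eq_fun do rewrite -[fine (tau _)]addr0.
apply: (@strong_markov_fixed_time _ T _ _ _ P S_polish T_time _ _ _ _ tau
  (stopped_sigma_algebra T (fun t => Z t) tau)) => //.
- move=> f x v u cf f01 Tu Tv uv v_cvg.
  (* The kernels issued from x are laws of a coordinate of the pair started on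
     the diagonal, hence inherit the right-continuity of its paths. *)
  apply: (kernel_right_cvg (Q := Pr (x, x)) (X := W)) => //.
  by move=> s Ts B mB; rewrite coordinate_law// pi_diag.
- exact: tau_stop.1.
- exact: stopped_le.
- by move=> n k s; exact: stopped_grid.
- move=> u Tu C B GC mB.
  have mpB : measurable (pi @^-1` B).
    by rewrite -[X in measurable X]setTI; exact: mpi.
  under eq_integral do rewrite WE -coordinate_kernel//.
  rewrite -(cond_prob_integral GM _ (Z_tau u _ Tu mpB) GC).
    by congr (Pr z (_ `&` _)); apply/seteqP; split => w /=; rewrite WE.
  exact: measurableT_comp (measurable_kernel (K u) _ mpB) mZ0.
Qed.

End coordinate.

Let X_right z : {ae Pr z, forall w, right_continuous_path T X w}.
Proof. by apply: filterS (Z_right z) => w []. Qed.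

Let X'_right z : {ae Pr z, forall w, right_continuous_path T X' w}.
Proof. by apply: filterS (Z_right z) => w []. Qed.

Lemma tau_ordered z (t : R) : {ae Pr z, forall w, tau w <= t%:E ->
  [/\ T (fine (tau w)), (fine (tau w) <= t)%R &
     (X (fine (tau w)) w <= X' (fine (tau w)) w)%O]}.
Proof.
apply: filterS (Z_right z) => w [Xw X'w].
have [->|[s Ts sw]] := tau_stop.1 w; first by rewrite leye_eq.
rewrite [tau w]sw lee_fin => st; split=> //=.
exact: order_time_attained Xw X'w.
Qed.

Lemma integral_increasing (u : R) (x y : S) (h : S -> R) :
  measurable_fun setT h -> (forall y, (0 <= h y <= 1)%R) ->
  {homo h : x y / (x <= y)%O >-> (x <= y)%R} -> T u -> (x <= y)%O ->
  \int[P u x]_y (h y)%:E <= \int[P u y]_y (h y)%:E.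
Proof.
move=> mh h01 h_incr Tu xy.
have h_ibS : ibS h.
  split=> //; exists 1%R => s; have /andP[h0 h1] := h01 s.
  by rewrite ger0_norm.
have fin s : \int[P u s]_y (h y)%:E \is a fin_num.
  have /andP[h0 h1] : 0 <= \int[P u s]_y (h y)%:E <= 1.
    apply: integral_bounded01; first exact: prob_kernel.
      exact/measurable_EFinP.
    by move=> s'; rewrite !lee_fin.
  by rewrite ge0_fin_numE// (le_lt_trans h1)// ltry.
have := P_incr Tu xy h_ibS.
by rewrite /Rintegral -lee_fin !fineK.
Qed.

(** On the event that the coordinates have crossed by time [t], their laws at
    time [t] are obtained by running increasing kernels from ordered positions
    for the same remaining time; the complementary event costs at most its
    probability, as [h] takes values in [0, 1]. *)
Lemma coupling_inequality z (t : R) (h : S -> R) :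
  measurable_fun setT h -> (forall y, (0 <= h y <= 1)%R) ->
  {homo h : x y / (x <= y)%O >-> (x <= y)%R} -> T t ->
  \int[P t z.1]_y (h y)%:E <=
  \int[P t z.2]_y (h y)%:E + Pr z [set w | t%:E < tau w].
Proof.
move=> mh h01 h_incr Tt; pose D := [set w | tau w <= t%:E].
have mhE : measurable_fun setT (EFin \o h) by exact/measurable_EFinP.
have h0 y : 0 <= (h y)%:E by rewrite lee_fin; case/andP: (h01 y).
have h1 y : (h y)%:E <= 1 by rewrite lee_fin; case/andP: (h01 y).
have mD : measurable D.
  by rewrite -[X in measurable X]setTI; exact: emeasurable_fun_infty_c.
have DC : [set w | t%:E < tau w] = ~` D.
  by apply/seteqP; split => w /=; rewrite /D/= ltNge => /negP.
have X1 := coordinate_law (pi := fst) (W := X) (fun _ _ => erefl)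
  measurable_fst X_markov z.
have X2 := coordinate_law (pi := snd) (W := X') (fun _ _ => erefl)
  measurable_snd X'_markov z.
have M1 := coordinate_strong_markov (pi := fst) (W := X) (fun _ _ => erefl)
  measurable_fst (fun=> erefl) X_markov X_right z Tt.
have M2 := coordinate_strong_markov (pi := snd) (W := X') (fun _ _ => erefl)
  measurable_snd (fun=> erefl) X'_markov X'_right z Tt.
have mX (W : R -> {mfun Omega >-> S}) (A : set Omega) : measurable A ->
    measurable_fun A (fun w => (h (W t w))%:E).
  by move=> mA; apply: measurable_funTS; exact: measurableT_comp mhE _.
rewrite (integral_markov_law (Pr1 z) X1 mhE h0 Tt).
rewrite (integral_markov_law (Pr1 z) X2 mhE h0 Tt) DC.
have splitX (W : R -> {mfun Omega >-> S}) : \int[Pr z]_w (h (W t w))%:E =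
    \int[Pr z]_(w in D) (h (W t w))%:E + \int[Pr z]_(w in ~` D) (h (W t w))%:E.
  rewrite -ge0_integral_setU//; [by rewrite setUv|exact: measurableC| |].
  - by rewrite setUv; exact: mX.
  - by apply/disj_setPS; rewrite setICr.
rewrite (splitX X) (splitX X') -addeA; apply: leeD.
  rewrite (integral_conditional_law mD (fun B mB => (M1 B mB).1) _
    (fun B mB => (M1 B mB).2) mhE h0); last exact: measurable_funTS.
  rewrite (integral_conditional_law mD (fun B mB => (M2 B mB).1) _
    (fun B mB => (M2 B mB).2) mhE h0); last exact: measurable_funTS.
  apply: ae_ge0_le_integral => //.
  - by move=> w _; apply: integral_ge0 => y _; exact: h0.
  - by apply: measurable_mixture => // B mB; exact: (M1 B mB).1.
  - by move=> w _; apply: integral_ge0 => y _; exact: h0.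
  - by apply: measurable_mixture => // B mB; exact: (M2 B mB).1.
  - apply: filterS (tau_ordered z t) => w tau_w Dw.
    have [Ts st Xw] := tau_w Dw.
    by apply: integral_increasing => //; exact: timeB.
rewrite (le_trans (y := Pr z (~` D)))//; last by rewrite leeDr// integral_ge0.
rewrite -[leRHS]mul1e -integral_cst; last exact: measurableC.
by apply: ge0_le_integral => //; [exact: measurableC|exact/mX/measurableC].
Qed.

(** Average of the previous inequality over independent starting points. *)
Lemma coupling_inequality_law (phi psi : probability S R) (t : R) (h : S -> R) :
  measurable_fun setT h -> (forall y, (0 <= h y <= 1)%R) ->
  {homo h : x y / (x <= y)%O >-> (x <= y)%R} -> T t ->
  \int[kact phi (P t)]_y (h y)%:E <= \int[kact psi (P t)]_y (h y)%:E +
  \int[phi]_x \int[psi]_y Pr (x, y) [set w | t%:E < tau w].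
Proof.
move=> mh h01 h_incr Tt.
have mhE : measurable_fun setT (EFin \o h) by exact/measurable_EFinP.
have h0 y : 0 <= (h y)%:E by rewrite lee_fin; case/andP: (h01 y).
have mA : measurable [set w | t%:E < tau w].
  by rewrite -[X in measurable X]setTI; exact: emeasurable_fun_o_infty.
have mP B : measurable B -> measurable_fun setT (fun x => P t x B).
  exact: measurable_kernel.
have kactE (mu : probability S R) :
    \int[kact mu (P t)]_y (h y)%:E = \int[mu]_x \int[P t x]_y (h y)%:E.
  exact: (integral_mixture (k := P t)).
have mPh : measurable_fun setT (fun x => \int[P t x]_y (h y)%:E).
  exact: measurable_mixture.
have Ph0 x : 0 <= \int[P t x]_y (h y)%:E by exact: integral_ge0.
have mPr : measurable_fun setT (fun z => Pr z [set w | t%:E < tau w]).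
  exact: measurable_kernel.
have mPr1 : measurable_fun setT
    (fun x => \int[psi]_y Pr (x, y) [set w | t%:E < tau w]).
  exact: (measurable_fun_fubini_tonelli_F (m2 := psi) _ mPr
    (fun=> measure_ge0 _ _)).
have mPr2 x : measurable_fun setT (fun y => Pr (x, y) [set w | t%:E < tau w]).
  by apply: (measurableT_comp mPr); exact: measurable_pair1.
rewrite !kactE.
rewrite -[X in _ <= X + _](mule1 _) -(probability_setT phi).
rewrite -integral_cst// -ge0_integralD//; last 2 first.
- by move=> x _; exact: integral_ge0.
- by move=> x _; exact: integral_ge0.
apply: ge0_le_integral => //.
  by apply: emeasurable_funD => //; exact: measurable_cst.
move=> x _ /=; rewrite -ge0_integralD//.
rewrite -[leLHS]mule1 -(probability_setT psi) -integral_cst//.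
apply: ge0_le_integral => //.
- by move=> y _; exact: integral_ge0.
- exact: emeasurable_funD.
- by move=> y _; exact: (coupling_inequality (x, y)).
Qed.

(** The events [tau > n] decrease to the null event [tau = +oo] under each
    [Pr z]; dominated convergence is applied to each of the two integrals. *)
Lemma uncoupled_cvg0 (phi psi : probability S R) :
  \int[phi]_x \int[psi]_y Pr (x, y) [set w | n%:R%:E < tau w] @[n --> \oo]
  --> 0.
Proof.
pose A n := [set w | n%:R%:E < tau w].
have mA n : measurable (A n).
  by rewrite -[X in measurable X]setTI; exact: emeasurable_fun_o_infty.
have mPr n : measurable_fun setT (fun z => Pr z (A n)).
  exact: measurable_kernel.
have mPr2 n x : measurable_fun setT (fun y => Pr (x, y) (A n)).
  by apply: (measurableT_comp (mPr n)); exact: measurable_pair1.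
have Pr01 n z : 0 <= Pr z (A n) <= 1.
  by rewrite measure_ge0/= -(Pr1 z); apply: le_measure; rewrite ?inE.
have A_cvg z : Pr z (A n) @[n --> \oo] --> 0.
  have <- : Pr z (\bigcap_n A n) = 0.
    have -> : \bigcap_n A n = ~` [set w | tau w < +oo].
      apply/seteqP; split => w /=.
        move=> Aw tw; have [tw'|[s Ts sw]] := tau_stop.1 w.
          by rewrite [tau w]tw' ltxx in tw.
        have := Aw (Num.truncn s).+1 I; rewrite /A/= [tau w]sw lte_fin.
        by rewrite ltNge ltW// truncnS_gt.
      by move=> /negP; rewrite -leNgt leye_eq => /eqP tw n _; rewrite /A/= tw ltry.
    have mtau_fin : measurable [set w | tau w < +oo].
      by rewrite -[X in measurable X]setTI; exact: emeasurable_fun_infty_o.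
    rewrite -setTD measureD//; last by rewrite [X in X < _]Pr1 ltry.
    by rewrite setTI [X in X - _]Pr1 [X in _ - X]tau_fin subee.
  apply: nonincreasing_cvg_mu => //.
  - by rewrite (le_lt_trans (y := 1)) ?ltry//; case/andP: (Pr01 0%N z).
  - exact: bigcapT_measurable.
  - move=> m n mn; apply/subsetPset => w; rewrite /A/=; apply: le_lt_trans.
    by rewrite lee_fin ler_nat.
have inner_cvg x : \int[psi]_y Pr (x, y) (A n) @[n --> \oo] --> 0.
  rewrite -[X in _ --> X](integral0 psi setT).
  apply: bounded_convergence => //.
  - by rewrite [X in X < _]probability_setT ltry.
  - by apply: aeW => y _; exact: A_cvg.
rewrite -[X in _ --> X](integral0 phi setT).
apply: bounded_convergence => //.
- by rewrite [X in X < _]probability_setT ltry.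
- by move=> n; exact: (measurable_fun_fubini_tonelli_F (m2 := psi) _ (mPr n)
    (fun=> measure_ge0 _ _)).
- by apply: aeW => x _; exact: inner_cvg.
- move=> n x _; exact: (integral_bounded01 (probability_setT psi) (mPr2 n x)
    (fun y => Pr01 n (x, y))).
Qed.

Lemma coupled_contractive : asymptotically_contractive T P.
Proof.
pose late (phi psi : probability S R) (t : R) :=
  \int[phi]_x \int[psi]_y Pr (x, y) [set w | t%:E < tau w].
have mlate t : measurable [set w | t%:E < tau w].
  by rewrite -[X in measurable X]setTI; exact: emeasurable_fun_o_infty.
have mPr t : measurable_fun setT (fun z => Pr z [set w | t%:E < tau w]).
  exact: measurable_kernel.
have mPr2 t x : measurable_fun setT (fun y => Pr (x, y) [set w | t%:E < tau w]).
  by apply: (measurableT_comp (mPr t)); exact: measurable_pair1.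
have late_le phi psi (s t : R) : (s <= t)%R -> late phi psi t <= late phi psi s.
  move=> st; apply: ge0_le_integral => //.
  - by move=> x _; exact: integral_ge0.
  - exact: (measurable_fun_fubini_tonelli_F (m2 := psi) _ (mPr t)
      (fun=> measure_ge0 _ _)).
  - exact: (measurable_fun_fubini_tonelli_F (m2 := psi) _ (mPr s)
      (fun=> measure_ge0 _ _)).
  move=> x _; apply: ge0_le_integral => //.
  move=> y _; apply: le_measure; rewrite ?inE//.
  by move=> w /=; apply: le_lt_trans; rewrite lee_fin.
move=> phi psi; apply/cvgrPdist_le => /= e e0.
have e2 : 0 < (e / 2)%:E by rewrite lte_fin divr_gt0.
have late_small mu nu : \forall n \near \oo, late mu nu n%:R < (e / 2)%:E.
  apply: (uncoupled_cvg0 mu nu (t := [set x | x < (e / 2)%:E])).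
  by apply: open_nbhs_nbhs; split => //; exact: open_ereal_lt_ereal.
have [n [late1 late2]] : exists n : nat,
    late phi psi n%:R < (e / 2)%:E /\ late psi phi n%:R < (e / 2)%:E.
  near \oo => n; exists n; split; near: n; exact: late_small.
rewrite near_withinE; near=> t => Tt.
have nt : (n%:R <= t)%R by near: t; exact: nbhs_pinfty_ge.
have /andP[b0 b1] :
    (0 <= beta (kact phi (P t)) (kact psi (P t)) <= 2 * (e / 2))%R.
  apply: beta_le => h mh h01 h_incr; split.
  - apply: (le_trans (coupling_inequality_law phi psi mh h01 h_incr Tt)).
    by apply: leeD2l; exact: le_trans (late_le _ _ _ _ nt) (ltW late1).
  - apply: (le_trans (coupling_inequality_law psi phi mh h01 h_incr Tt)).
    by apply: leeD2l; exact: le_trans (late_le _ _ _ _ nt) (ltW late2).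
by rewrite sub0r normrN ger0_norm//; lra.
Unshelve. all: by end_near. Qed.

End Coupling.

Theorem propositionA1 (R : realType) (d : Order.disp_t) (dm : measure_display)
    (S : poTopMeasurableType d dm) (T : set R) (P : R -> R.-pker S ~> S)
    (S_polish : po_polish R S)
    (S_compact : forall A : set S, compact A <-> closed A /\ order_bounded A)
    (T_time : time_set T)
    (P_tf : transition_function T P)
    (P_incr : increasing_tf T P)
    (P_mixing : weakly_order_mixing T P) :
  asymptotically_contractive T P.
Proof.
have [dO [Om [X [X' [Pr [K [Z_props [tau_stop mtau tau_fin]]]]]]]] := P_mixing.
apply: (coupled_contractive (Pr := Pr) (K := K) S_polish T_time P_incr _ _ _ _ _
  tau_stop mtau tau_fin) => z; by have [] := Z_props z.
Qed.
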